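(* Let $a,b\in B_3^+$. Then $a$ and $b$ are conjugate (in $B_3$) if and only if either $a$ and $b$ are cyclic equivalent, or $a$ is cyclic equivalent to the reflection $\overline{b}$ of $b$. Moreover, if $a$ has positive infimum (i.e. $\inf(a)\ge 1$), then $a$ and $b$ are conjugate if and only if they are cyclic equivalent.
   Context: $B_3$ is the braid group on $3$ strands, with generators $\sigma_1,\sigma_2$ and the single defining relation $\sigma_1\sigma_2\sigma_1=\sigma_2\sigma_1\sigma_2$. $B_3^+$ is the positive braid monoid, with the same generators and relation; it embeds in $B_3$ and is identified with the submonoid of $B_3$ generated by $\sigma_1,\sigma_2$. A positive word is a finite (possibly empty) word in the letters $\sigma_1,\sigma_2$. Conjugate means conjugate in the group $B_3$. Garside element: $\Delta_3=\sigma_1\sigma_2\sigma_1$. Cyclic equivalence: $a,b\in B_3^+$ are cyclic equivalent, written $a\sim_\circlearrowright b$, if there is a finite sequence $a=a_0,a_1,\dots,a_m=b$ in $B_3^+$ such that for each $i=0,\dots,m-1$ there are positive words $w_1,w_2$ (depending on $i$) with $w_1w_2$ representing $a_i$ and $w_2w_1$ representing $a_{i+1}$. Infimum: every $a\in B_3$ can be written uniquely as $a=\Delta_3^mP$ with $m\in\mathbb{Z}$ and $P\in B_3^+$ not containing $\Delta_3$ as a factor (i.e. $P$ is not of the form $u\Delta_3 v$ with $u,v\in B_3^+$); then $\inf(a):=m$. Reflection: $\overline{a}:=\Delta_3^{-1}a\Delta_3=\Delta_3a\Delta_3^{-1}$ for $a\in B_3$; it is the automorphism exchanging $\sigma_1$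 and $\sigma_2$, and it preserves $B_3^+$. *)

(* Defs.v *)
From HB Require Import structures.
From mathcomp Require Import all_boot ssralg ssrint.
From mathcomp Require Import boolp.

Set Implicit Arguments.
Unset Strict Implicit.
Unset Printing Implicit Defensive.

Import GRing.Theory.
Local Open Scope group_scope.
Local Open Scope quotient_scope.

(* The generator index [false] stands for sigma_1 and [true] for sigma_2, so
   that [negb] exchanges the two generators.  In a signed letter [(i, e)] the
   flag [e] is [true] for the inverse generator. *)
Notation gen := bool (only parsing).
Notation letter := (gen * bool)%type (only parsing).
Notation word := (seq letter) (only parsing).

(* The congruence on signed words generated by free cancellation and by
   s1 s2 s1 = s2 s1 s2; its quotient is the group with that presentation. *)
Inductive braid_cong : word -> word -> Prop :=
  | bc_refl u : braid_cong u u
  | bc_sym u v : braid_cong u v -> braid_cong v u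
  | bc_trans u v w : braid_cong u v -> braid_cong v w -> braid_cong u w
  | bc_cat u u' v v' :
      braid_cong u u' -> braid_cong v v' -> braid_cong (u ++ v) (u' ++ v')
  | bc_cancel i e : braid_cong [:: (i, e); (i, ~~ e)] [::]
  | bc_braid : braid_cong
      [:: (false, false); (true, false); (false, false)]
      [:: (true, false); (false, false); (true, false)].

Definition braid_congb : rel word := fun u v => `[< braid_cong u v >].

Lemma braid_congb_equiv : equiv_class_of braid_congb.
Proof.
split.
- by move=> u; apply/asboolP/bc_refl.
- by move=> u v; apply/asboolP/asboolP; apply: bc_sym.
- move=> v u w /asboolP uv /asboolP vw; apply/asboolP; exact: bc_trans vw.
Qed.

Canonical braid_congb_equivRel := EquivRelPack braid_congb_equiv.

Definition B3 : Type := {eq_quot braid_congb}.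
HB.instance Definition _ := Choice.on B3.
HB.instance Definition _ := EqQuotient.on B3.

Definition cls (w : word) : B3 := \pi_B3 w.

Lemma clsP u v : cls u = cls v <-> braid_cong u v.
Proof.
rewrite /cls; split=> [/eqquotP|uv]; first by move/asboolP.
by apply/eqquotP/asboolP.
Qed.

Lemma cls_repr (a : B3) : cls (repr a) = a.
Proof. exact: reprK. Qed.

Definition word_inv (w : word) : word := rev [seq (x.1, ~~ x.2) | x <- w].

Definition B3_mul (a b : B3) : B3 := cls (repr a ++ repr b).
Definition B3_one : B3 := cls [::].
Definition B3_inv (a : B3) : B3 := cls (word_inv (repr a)).

Lemma cls_cat u v : cls (u ++ v) = B3_mul (cls u) (cls v).
Proof. by apply/clsP/bc_cat; apply/clsP; rewrite cls_repr. Qed.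

Lemma word_inv_cat u v : word_inv (u ++ v) = word_inv v ++ word_inv u.
Proof. by rewrite /word_inv map_cat rev_cat. Qed.

Lemma word_invK : involutive word_inv.
Proof.
move=> w; rewrite /word_inv map_rev revK -map_comp -[RHS]map_id.
by apply: eq_map => -[i e] /=; rewrite negbK.
Qed.

Lemma braid_cong_word_inv u : braid_cong (u ++ word_inv u) [::].
Proof.
elim: u => [|[i e] u IHu]; first exact: bc_refl.
rewrite -cat1s word_inv_cat catA -(catA [:: _]).
apply: bc_trans (bc_cancel i e).
rewrite -[X in braid_cong _ X]/([:: (i, e)] ++ [:: (i, ~~ e)]).
apply: bc_cat (bc_refl _); rewrite -[X in braid_cong _ X]cats0.
exact: bc_cat (bc_refl _) IHu.
Qed.

Lemma B3_mulA : associative B3_mul.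
Proof.
move=> a b c; rewrite -(cls_repr a) -(cls_repr b) -(cls_repr c).
by rewrite -!cls_cat catA.
Qed.

Lemma B3_mul1 : left_id B3_one B3_mul.
Proof. by move=> a; rewrite -(cls_repr a) /B3_one -cls_cat. Qed.

Lemma B3_mulr1 : right_id B3_one B3_mul.
Proof. by move=> a; rewrite -(cls_repr a) /B3_one -cls_cat cats0. Qed.

Lemma B3_mulV : right_inverse B3_one B3_inv B3_mul.
Proof.
move=> a; rewrite -{1}(cls_repr a) /B3_inv -cls_cat.
exact/clsP/braid_cong_word_inv.
Qed.

Lemma B3_mulVl : left_inverse B3_one B3_inv B3_mul.
Proof.
move=> a; rewrite -{2}(cls_repr a) /B3_inv -cls_cat -{2}(word_invK (repr a)).
exact/clsP/braid_cong_word_inv.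
Qed.

HB.instance Definition _ := isGroup.Build B3
  B3_mulA B3_mul1 B3_mulr1 B3_mulVl B3_mulV.

Lemma clsM u v : cls (u ++ v) = cls u * cls v.
Proof. exact: cls_cat. Qed.

Definition sigma (i : gen) : B3 := cls [:: (i, false)].

Definition sigma1 : B3 := sigma false.
Definition sigma2 : B3 := sigma true.

(* Locked so that unification does not unfold it into a product when rewriting
   with [mulgA]; unfold it with [Delta3.unlock]. *)
HB.lock Definition Delta3 : B3 := sigma1 * sigma2 * sigma1.

(* A positive word is an element of [seq gen]; this is the braid it represents. *)
Definition braid_of (w : seq gen) : B3 := \prod_(i <- w) sigma i.

(* Membership in B_3^+, seen as the submonoid of B_3 generated by s1 and s2. *)
Definition positive (a : B3) : Prop := exists w : seq gen, braid_of w = a.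

(* [a ^ c] is [c^-1 * (a * c)]. *)
Definition conjugate (a b : B3) : Prop := exists c : B3, b = a ^ c.

Definition cyclic_step (a b : B3) : Prop :=
  exists w1 w2 : seq gen, braid_of (w1 ++ w2) = a /\ braid_of (w2 ++ w1) = b.

Definition cyclic_equiv (a b : B3) : Prop :=
  exists (m : nat) (s : nat -> B3),
    [/\ s 0 = a, s m = b, forall i, i <= m -> positive (s i)
      & forall i, i < m -> cyclic_step (s i) (s i.+1)].

(* See [reflectionE] and [reflection_sigma] for the equivalent descriptions. *)
Definition reflection (a : B3) : B3 := Delta3^-1 * a * Delta3.

Definition contains_Delta3 (P : B3) : Prop :=
  exists u v : B3, [/\ positive u, positive v & P = u * Delta3 * v].

Lemma Delta3_generators i :
  [/\ Delta3 = sigma i * sigma (~~ i) * sigma i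
    & Delta3 = sigma (~~ i) * sigma i * sigma (~~ i)].
Proof.
have e : sigma1 * sigma2 * sigma1 = sigma2 * sigma1 * sigma2.
  by rewrite /sigma1 /sigma2 /sigma -!clsM; apply/clsP; exact: bc_braid.
by case: i; split; rewrite Delta3.unlock.
Qed.

Lemma Delta3_sigma i : Delta3 * sigma i = sigma (~~ i) * Delta3.
Proof.
have [e1 e2] := Delta3_generators i.
by rewrite [in LHS]e2 [in RHS]e1 !mulgA.
Qed.

Lemma sigma_Delta3 i : sigma i * Delta3 = Delta3 * sigma (~~ i).
Proof. by rewrite Delta3_sigma negbK. Qed.

Lemma reflection_sigma i : reflection (sigma i) = sigma (~~ i).
Proof. by rewrite /reflection -mulgA sigma_Delta3 mulKg. Qed.

Lemma braid_of_cons i w : braid_of (i :: w) = sigma i * braid_of w.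
Proof. by rewrite /braid_of big_cons. Qed.

Lemma braid_of_cat u v : braid_of (u ++ v) = braid_of u * braid_of v.
Proof. by rewrite /braid_of big_cat. Qed.

Lemma braid_of_Delta3 w :
  braid_of w * Delta3 = Delta3 * braid_of (map negb w).
Proof.
elim: w => [|i w IHw]; first by rewrite /braid_of !big_nil mul1g mulg1.
by rewrite /= !braid_of_cons -mulgA IHw !mulgA sigma_Delta3.
Qed.

Lemma positive_one : positive 1.
Proof. by exists [::]; rewrite /braid_of big_nil. Qed.

Lemma positive_sigma i : positive (sigma i).
Proof. by exists [:: i]; rewrite /braid_of big_seq1. Qed.

Lemma positive_mul a b : positive a -> positive b -> positive (a * b).
Proof. by move=> [u <-] [v <-]; exists (u ++ v); rewrite braid_of_cat. Qed.

Lemma positive_Delta3 : positive Delta3.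
Proof.
have [-> _] := Delta3_generators false.
by do !apply: positive_mul; apply: positive_sigma.
Qed.

Lemma positive_expg a n : positive a -> positive (a ^+ n).
Proof.
move=> pa; elim: n => [|n IHn]; first exact: positive_one.
by rewrite expgS; apply: positive_mul.
Qed.

Lemma positive_reflection a : positive a -> positive (reflection a).
Proof.
move=> [w <-]; exists (map negb w).
by rewrite /reflection -mulgA braid_of_Delta3 mulKg.
Qed.

Lemma braid_of_gen_ind (Q : B3 -> Prop) :
  Q 1 -> (forall i a, Q a -> Q (sigma i * a)) ->
  (forall i a, Q a -> Q ((sigma i)^-1 * a)) -> forall a, Q a.
Proof.
move=> Q1 Qs QV a; rewrite -(cls_repr a); elim: (repr a) => [//|[i e] w IHw].
have -> : cls ((i, e) :: w) = cls [:: (i, e)] * cls w by rewrite -clsM.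
case: e; last exact: Qs.
suff -> : cls [:: (i, true)] = (sigma i)^-1 by exact: QV.
apply/(mulgI (sigma i)); rewrite mulgV -[LHS]clsM.
by apply/clsP; exact: bc_cancel.
Qed.

Lemma reflectionE (a : B3) : reflection a = Delta3 * a * Delta3^-1.
Proof.
apply: (mulIg Delta3); rewrite mulgVK.
suff e : Delta3 * Delta3 * a = a * (Delta3 * Delta3).
  by apply: (mulgI Delta3); rewrite /reflection !mulgA mulgV mul1g e mulgA.
have Dl x : Delta3 * Delta3 * sigma x = sigma x * (Delta3 * Delta3).
  by rewrite -mulgA Delta3_sigma mulgA Delta3_sigma negbK mulgA.
elim/braid_of_gen_ind: a => [|i a IHa|i a IHa]; first by rewrite mulg1 mul1g.
  by rewrite mulgA Dl -mulgA IHa mulgA.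
apply: (mulgI (sigma i)).
by rewrite [LHS]mulgA -Dl -[LHS]mulgA mulVKg mulgA mulVKg IHa.
Qed.

Definition letter_exp (l : gen * bool) : int := if l.2 then (-1)%R else 1%R.

Definition exponent_sum (w : word) : int := (\sum_(l <- w) letter_exp l)%R.

Lemma braid_cong_exponent_sum u v :
  braid_cong u v -> exponent_sum u = exponent_sum v.
Proof.
rewrite /exponent_sum; elim=> {u v} //.
- by move=> u v w _ -> _ ->.
- by move=> u u' v v' _ e1 _ e2; rewrite !big_cat /= e1 e2.
- by move=> i [] ; rewrite !big_cons !big_nil.
- by rewrite !big_cons !big_nil.
Qed.

Lemma braid_of_size u v : braid_of u = braid_of v -> size u = size v.
Proof.
have bE w : braid_of w = cls [seq (i, false) | i <- w].
  elim: w => [|i w IHw]; first by rewrite /braid_of big_nil.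
  by rewrite braid_of_cons IHw -[LHS]clsM.
have sE w : exponent_sum [seq (i, false) | i <- w] = size w.
  elim: w => [|i w IHw]; first by rewrite /exponent_sum big_nil.
  by rewrite /exponent_sum /= big_cons -/(exponent_sum _) IHw.
rewrite !bE => /clsP/braid_cong_exponent_sum; rewrite !sE.
by case.
Qed.

Definition expgz (G : groupType) (x : G) (m : int) : G :=
  match m with Posz n => x ^+ n | Negz n => x ^- n.+1 end.

Lemma expgzS (G : groupType) (x : G) m : expgz x (m + 1)%R = x * expgz x m.
Proof.
case: m => n; first by rewrite -PoszD addn1 -expgS.
case: n => [|n]; first exact/esym/mulgV.
rewrite NegzE -(addn1 n.+1) PoszD opprD addrNK -NegzE /=.
by rewrite addn0 (expgSr x n.+1) invgM mulVKg.
Qed.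

Lemma expgzD (G : groupType) (x : G) m n :
  expgz x (m + n)%R = expgz x m * expgz x n.
Proof.
elim/int_ind: m => [|m IHm|m IHm]; first by rewrite add0r mul1g.
  by rewrite -addn1 PoszD addrAC !expgzS IHm mulgA.
apply: (mulgI x); rewrite mulgA -!expgzS addrAC -addn1 PoszD opprD.
by rewrite addrNK.
Qed.

Definition is_inf (a : B3) (m : int) : Prop :=
  exists P : B3,
    [/\ positive P, ~ contains_Delta3 P & a = expgz Delta3 m * P].

Lemma positive_is_inf a : positive a -> exists m, is_inf a m.
Proof.
move=> [w <-]; have [n] := ubnP (size w); elim: n w => // n IHn w lew.
have [cD|ncD] := pselect (contains_Delta3 (braid_of w)); last first.
  by exists 0%R, (braid_of w); split; [exists w | | rewrite mul1g].
have [_ [_ [[u <-] [v <-] ew]]] := cD.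
have ew' : braid_of w = braid_of ([:: false; true; false] ++ map negb u ++ v).
  rewrite ew braid_of_Delta3 !braid_of_cat !mulgA; congr (_ * _ * _).
  have [-> _] := Delta3_generators false.
  by rewrite /braid_of !big_cons big_nil mulg1 mulgA.
have := braid_of_size ew'; rewrite /= => sw.
have [|m [P [pP nP eP]]] := IHn (map negb u ++ v).
  by move: lew; rewrite sw ltnS => /ltnW/ltnW.
exists (m + 1)%R, P; split => //.
by rewrite expgzS -mulgA -eP ew braid_of_Delta3 braid_of_cat mulgA.
Qed.

Lemma positive_Delta3_expgN n a :
  positive a -> positive (Delta3 ^+ n * a * Delta3 ^- n).
Proof.
move=> pa; elim: n => [|n IHn]; first by rewrite invg1 mulg1 mul1g.
have -> : Delta3 ^+ n.+1 * a * Delta3 ^- n.+1 =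
          reflection (Delta3 ^+ n * a * Delta3 ^- n).
  by rewrite reflectionE expgS invgM !mulgA.
exact: positive_reflection.
Qed.

Lemma positive_denominator (a : B3) : exists k, positive (Delta3 ^+ k * a).
Proof.
elim/braid_of_gen_ind: a => [|i a [k pa]|i a [k pa]].
- by exists 0; rewrite mul1g; apply: positive_one.
- exists k; have -> : Delta3 ^+ k * (sigma i * a) =
    Delta3 ^+ k * sigma i * Delta3 ^- k * (Delta3 ^+ k * a).
    by rewrite !mulgA mulgVK.
  by apply/positive_mul/pa/positive_Delta3_expgN/positive_sigma.
- exists k.+1; have [_ eD] := Delta3_generators (~~ i).
  have -> : Delta3 ^+ k.+1 * ((sigma i)^-1 * a) =
    Delta3 ^+ k * (sigma i * sigma (~~ i)) * Delta3 ^- k * (Delta3 ^+ k * a).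
    rewrite negbK in eD.
    by rewrite mulgA mulgA mulgVK expgSr {2}eD !mulgA mulgK.
  apply/positive_mul/pa/positive_Delta3_expgN.
  by apply/positive_mul; apply: positive_sigma.
Qed.

Lemma is_inf_exists (a : B3) : exists m, is_inf a m.
Proof.
have [k /positive_is_inf[m [P [pP nP eP]]]] := positive_denominator a.
exists (- k%:Z + m)%R, P; split => //; rewrite expgzD -mulgA -eP mulgA.
by rewrite -[Delta3 ^+ k]/(expgz Delta3 k) -expgzD addNr mul1g.
Qed.

Lemma is_inf_unique (a : B3) m n : is_inf a m -> is_inf a n -> m = n.
Proof.
wlog: m n / exists k : nat, n = (m + k%:Z)%R.
  move=> W im jn; have := subrK m n; case: (intP (n - m)%R) => [|k|k] e.
  - by rewrite -e add0r.
  - by apply: W => //; exists k.+1; rewrite -e addrC.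
  - by apply/esym/W => //; exists k.+1; rewrite -e addrAC addNr add0r.
move=> [[|k] ->]; first by rewrite addr0.
move=> [P [pP nP eP]] [Q [pQ nQ eQ]]; case: nP.
exists 1, (Delta3 ^+ k * Q); split; first exact: positive_one.
  exact/positive_mul/pQ/positive_expg/positive_Delta3.
move: eQ; rewrite eP expgzD -mulgA => /mulgI ->.
by rewrite /= expgS mul1g mulgA.
Qed.

(* The integer selected here is the only one satisfying [is_inf a], by
   [is_inf_unique]. *)
Definition infimum (a : B3) : int := projT1 (cid (is_inf_exists a)).

Lemma infimumP (a : B3) : is_inf a (infimum a).
Proof. exact: (projT2 (cid (is_inf_exists a))). Qed.

(* Main.v *)
(** Words without a factor [i, ~~ i, i] are normal forms of [B_3] modulo right
    multiplication by powers of [Delta3], and [B_3] acts on them by left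
    multiplication.  Hence distinct words of this kind represent distinct
    braids, and a positive braid divisible on the left by both generators is
    divisible by [Delta3].

    Since [Delta3 ^+ 2] is central, a conjugator from [a] to [b] may be taken
    positive.  Peel off its greatest simple left factor [s], writing
    [Delta3 = s * t].  Either [a] starts with the first letter of [s], and
    conjugating by that letter is a cyclic step, or [a * s = Delta3 * r] with
    [r] positive.  In the latter case [a] conjugated by [s] is [t * r], whereas
    [a = reflection r * reflection t] is one cyclic step away from
    [reflection (t * r)]. *)
Require Import Defs.
From mathcomp Require Import all_boot ssralg ssrnum ssrint.
From mathcomp Require Import boolp.

Set Implicit Arguments.
Unset Strict Implicit.
Unset Printing Implicit Defensive.

Local Open Scope group_scope.

(** * The action of $B_3$ on Delta-free words, and uniqueness of normal forms *)

Fixpoint Delta_free (w : seq bool) : bool :=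
  if w is i :: w' then ~~ prefix [:: ~~ i; i] w' && Delta_free w' else true.

(** Modulo right powers of [Delta3], the inverse of [sigma i] is
    [sigma (~~ i) * sigma i * Delta3^-1]. A [Delta3] of either sign is pushed to the right and
    dropped, reflecting the letters it crosses. *)
Definition letter_act (l : bool * bool) (w : seq bool) : seq bool :=
  let: (i, e) := l in
  if e then if prefix [:: i] w then behead w else [:: ~~ i, i & map negb w]
  else if prefix [:: ~~ i; i] w then map negb (drop 2 w) else i :: w.

Definition word_act (u : seq (bool * bool)) (w : seq bool) : seq bool :=
  foldr letter_act w u.

Lemma map_negbK : involutive (map negb).
Proof. exact: mapK negbK. Qed.

Lemma Delta_free_map w : Delta_free (map negb w) = Delta_free w.
Proof.
elim: w => //= i w ->; congr (~~ _ && _).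
by case: i; case: w => [|[] [|[] w]] //=; rewrite !prefix0s.
Qed.

Lemma letter_act_free l w : Delta_free w -> Delta_free (letter_act l w).
Proof.
case: l => i [] /=; last first.
  case: ifP => [|npre fw /=]; last by rewrite npre.
  case: w => [|j [|k w]] //= _ /andP[_ /andP[_ fw]].
  by rewrite drop0 Delta_free_map.
case: w => [|j w] /=; first by case: i.
rewrite prefix0s andbT => /andP[nw fw]; case: eqP => //= ij.
rewrite Delta_free_map fw.
by move: ij nw {fw}; case: i; case: j => //; case: w => [|[] [|[] w]] //=;
  rewrite prefix0s.
Qed.

Lemma word_act_free u w : Delta_free w -> Delta_free (word_act u w).
Proof. by move=> fw; elim: u => //= l u; apply: letter_act_free. Qed.

(** Delta-freeness matters when [w] is [~~ i, i, w']: the letter [i] turns it into [map negb w'],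
    and the inverse letter restores [w] only if [w'] does not begin with [~~ i]. *)
Lemma letter_actK i e w : Delta_free w ->
  letter_act (i, e) (letter_act (i, ~~ e) w) = w.
Proof.
case: e => /=; last first.
  case: w => [|j w] /=; first by rewrite !eqxx.
  rewrite prefix0s andbT; case: eqP => [<-|ij] /andP[nw fw] /=.
    by rewrite (negPf nw).
  by rewrite !eqxx /= negbK map_negbK.
case: (boolP (prefix [:: ~~ i; i] w)) => [|_ _]; last first.
  by rewrite /= eqxx prefix0s.
case: w => [|j [|k w]] //; rewrite /= ?andbF // prefix0s andbT drop0.
move=> /andP[/eqP <- /eqP <-] /andP[nw _].
by case: w nw => [|[] w]; case: i => //=; rewrite ?prefix0s ?map_negbK.
Qed.

Lemma word_act_Delta i w : Delta_free w ->
  word_act [:: (i, false); (~~ i, false); (i, false)] w = map negb w.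
Proof.
by case: i; case: w => [|[] [|[] [|[] w]]] //=; rewrite ?prefix0s ?drop0 //=;
  rewrite ?prefix0s ?drop0.
Qed.

Lemma braid_cong_act u v w :
  braid_cong u v -> Delta_free w -> word_act u w = word_act v w.
Proof.
move=> uv; elim: uv w => {u v}.
- by [].
- by move=> u v _ IH w /IH.
- by move=> u v x _ IH1 _ IH2 w fw; rewrite IH1 // IH2.
- move=> u u' v v' _ IHu _ IHv w fw.
  by rewrite /word_act !foldr_cat -!/(word_act _ _) IHv // IHu // word_act_free.
- by move=> i e w fw; exact: letter_actK.
- by move=> w fw; rewrite (word_act_Delta false fw) (word_act_Delta true fw).
Qed.

Lemma braid_ofE w : braid_of w = cls [seq (i, false) | i <- w].
Proof.
elim: w => [|i w IHw]; first by rewrite /braid_of big_nil.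
by rewrite braid_of_cons IHw -[LHS]clsM.
Qed.

(** A Delta-free word is recovered from its braid by acting on the empty word, since no reduction
    occurs while it is rebuilt. *)
Lemma braid_of_free_inj u v :
  Delta_free u -> Delta_free v -> braid_of u = braid_of v -> u = v.
Proof.
have nf w : Delta_free w -> word_act [seq (i, false) | i <- w] [::] = w.
  by elim: w => //= i w IHw /andP[/negPf nw /IHw ->]; rewrite nw.
move=> fu fv; rewrite !braid_ofE => /clsP/braid_cong_act => /(_ [::] isT).
by rewrite !nf.
Qed.

Lemma not_Delta_free w : ~~ Delta_free w ->
  exists2 r, positive r & braid_of w = Delta3 * r.
Proof.
elim: w => //= i w IHw; rewrite negb_and negbK => /orP[|/IHw[r pr wE]].
  case: w {IHw} => [|j [|k w]] //; rewrite /= ?andbF // prefix0s andbT.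
  move=> /andP[/eqP <- /eqP <-]; exists (braid_of w); first by exists w.
  by rewrite !braid_of_cons !mulgA; have [-> _] := Delta3_generators i.
exists (sigma (~~ i) * r); first exact/positive_mul/pr/positive_sigma.
by rewrite braid_of_cons wE !mulgA sigma_Delta3.
Qed.

(** * Left divisibility in the positive monoid *)

Definition left_div (i : bool) (x : B3) : Prop :=
  exists2 y, positive y & x = sigma i * y.

(** Two words for [x] with different first letters cannot both be Delta-free, so one of them yields
    a factor [Delta3]. *)
Lemma left_div_both i x : left_div i x -> left_div (~~ i) x ->
  exists2 r, positive r & x = Delta3 * r.
Proof.
move=> [_ [u <-] ->] [_ [v <-]]; rewrite -!braid_of_cons => uv.
have [fu|/not_Delta_free//] := boolP (Delta_free (i :: u)).
have [fv|/not_Delta_free[r pr e]] := boolP (Delta_free (~~ i :: v)).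
  by have [] := braid_of_free_inj fu fv uv; case: (i).
by exists r => //; rewrite uv.
Qed.

Lemma left_div_Delta3 i r : positive r -> left_div i (Delta3 * r).
Proof.
move=> pr; have [-> _] := Delta3_generators i.
exists (sigma (~~ i) * sigma i * r); last by rewrite !mulgA.
by apply/positive_mul/pr/positive_mul; apply: positive_sigma.
Qed.

Lemma left_div_sigma i x : positive x -> left_div i (sigma i * x).
Proof. by exists x. Qed.

Lemma left_divMr i x y : left_div i x -> positive y -> left_div i (x * y).
Proof.
by move=> [z pz ->] py; exists (z * y); [exact: positive_mul | rewrite mulgA].
Qed.

Lemma positive_left_div x : positive x -> x = 1 \/ exists i, left_div i x.
Proof.
move=> [[|i w] <-]; first by left; rewrite /braid_of big_nil.
by right; exists i, (braid_of w); [exists w | rewrite braid_of_cons].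
Qed.

Lemma left_div_lcm i x : left_div (~~ i) (sigma i * x) -> positive x ->
  exists2 r, positive r & x = sigma (~~ i) * sigma i * r.
Proof.
move=> dx px; have [r pr e] := left_div_both (left_div_sigma i px) dx.
exists r => //; apply: (mulgI (sigma i)).
by rewrite e !mulgA; have [-> _] := Delta3_generators i.
Qed.

(* The first simple factor of [y * sigma j * c] depends only on [y] and the
   first simple factor of [sigma j * c]. *)
Lemma left_div_weighted i j y c : positive y -> positive c ->
  ~ left_div (~~ j) c -> left_div i (y * sigma j * c) ->
  left_div i (y * sigma j).
Proof.
move=> [w <-] pc nc; have [n] := ubnP (size w).
have pS := positive_sigma; have pw u : positive (braid_of u) by exists u.
have base k : left_div k (sigma j * c) -> k = j.
  move=> dk; have [//|kj] : k = j \/ k = ~~ j by case: (k); case: (j); auto.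
  subst k; have [r pr ec] := left_div_lcm dk pc; case: nc.
  by rewrite ec -mulgA; apply/left_div_sigma/positive_mul.
elim: n => // n IHn in i w *; case: w => [|k w]; rewrite ltnS => lew.
  rewrite /braid_of big_nil mul1g => /base ->.
  by rewrite -[sigma j]mulg1; apply/left_div_sigma/positive_one.
rewrite braid_of_cons -!mulgA.
have [->|ik] : i = k \/ i = ~~ k by case: (i); case: (k); auto.
  by move=> _; apply/left_div_sigma/positive_mul.
(* What follows [sigma k] must begin with [sigma (~~ k) * sigma k]. The induction hypothesis then
   applies after dropping one letter if the next one is [k], and two if it is [~~ k]. *)
subst i => /left_div_lcm[|r pr e]; first by do !apply: positive_mul.
case: w => [|l w] in lew e *.
  move: e; rewrite /braid_of big_nil !mul1g -mulgA => e.
  have kj : ~~ k = j.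
    by apply: base; rewrite e; apply/left_div_sigma/positive_mul.
  case: nc; rewrite -kj negbK; move: e; rewrite kj => /mulgI ->.
  exact: left_div_sigma.
have [kl|kl] : l = k \/ l = ~~ k by case: (l); case: (k); auto.
  subst l; have [] := @left_div_both k (braid_of (k :: w) * sigma j).
  - by rewrite braid_of_cons -mulgA; apply/left_div_sigma/positive_mul.
  - apply: IHn => //; rewrite -mulgA e -mulgA.
    exact/left_div_sigma/positive_mul.
  move=> v pv ->; rewrite mulgA sigma_Delta3 -mulgA.
  exact/left_div_Delta3/positive_mul.
subst l; have [|z pz e'] := IHn k w (ltnW lew).
  move: e; rewrite braid_of_cons -!mulgA => /mulgI ->.
  exact: left_div_sigma.
rewrite braid_of_cons -mulgA e' !mulgA.
by have [<- _] := Delta3_generators k; apply: left_div_Delta3.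
Qed.

(** * Reflection and cyclic equivalence *)

Lemma reflectionM x y : reflection (x * y) = reflection x * reflection y.
Proof. by rewrite /reflection !mulgA mulgK. Qed.

Lemma reflectionK : involutive reflection.
Proof.
by move=> x; rewrite reflectionE /reflection !mulgA mulgV mul1g mulgK.
Qed.

Lemma reflection_braid_of w : reflection (braid_of w) = braid_of (map negb w).
Proof. by rewrite /reflection -mulgA braid_of_Delta3 mulKg. Qed.

Lemma cyclic_equiv_refl a : positive a -> cyclic_equiv a a.
Proof. by exists 0, (fun=> a). Qed.

Lemma cyclic_equiv_swap u v :
  positive u -> positive v -> cyclic_equiv (u * v) (v * u).
Proof.
move=> pu pv; exists 1%N, (fun n => if n is 0 then u * v else v * u).
split=> // [i _|[|//] _]; first by case: i => [|i]; apply: positive_mul.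
by case: pu pv => [u' <-] [v' <-]; exists u', v'; rewrite !braid_of_cat.
Qed.

Lemma cyclic_equiv_trans a b c :
  cyclic_equiv a b -> cyclic_equiv b c -> cyclic_equiv a c.
Proof.
move=> [m [s [<- <- ps ss]]] [n [t [st <- pt tt]]].
exists (m + n), (fun i => if i <= m then s i else t (i - m)); split=> [||i|i].
- by [].
- case: n {pt tt} => [|n]; first by rewrite addn0 leqnn st.
  by rewrite addnS ltnNge leq_addr -addnS addKn.
- by move=> imn; case: leqP => [/ps//|mi]; apply: pt; rewrite leq_subLR.
- move=> imn; case: (ltngtP i m) => [im|mi|im].
  + exact: ss.
  + by rewrite subSn ?(ltnW mi) //; apply: tt; rewrite ltn_subLR // ltnW.
  + subst i; rewrite subSnn -st; apply: tt.
    by rewrite -(ltn_add2l m) addn0.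
Qed.

Lemma cyclic_equiv_reflection a b :
  cyclic_equiv a b -> cyclic_equiv (reflection a) (reflection b).
Proof.
move=> [m [s [<- <- ps ss]]]; exists m, (reflection \o s).
split=> // i im /=; first exact/positive_reflection/ps.
have [u [v [<- <-]]] := ss i im; exists (map negb u), (map negb v).
by rewrite -!map_cat !reflection_braid_of.
Qed.

Lemma cyclic_equiv_conjugate a b : cyclic_equiv a b -> conjugate a b.
Proof.
move=> [m [s [<- <- _]]]; elim: m => [|m IHm] ss.
  by exists 1; rewrite conjg1.
have [i im|c ec] := IHm; first exact/ss/ltnW.
have [u [v [e1 e2]]] := ss m (ltnSn m); exists (c * braid_of u).
by rewrite conjgM -ec -e1 -e2 !braid_of_cat conjgE -mulgA mulKg.
Qed.

(** * Conjugacy implies cyclic equivalence up to reflection *)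

Definition cyclic_or_reflection a b :=
  cyclic_equiv a b \/ cyclic_equiv a (reflection b).

Lemma cyclic_or_reflection_trans a b c :
  cyclic_or_reflection a b -> cyclic_or_reflection b c ->
  cyclic_or_reflection a c.
Proof.
move=> [ab|ab] [bc|bc]; first by left; apply: cyclic_equiv_trans bc.
- by right; apply: cyclic_equiv_trans bc.
- by right; apply: cyclic_equiv_trans ab (cyclic_equiv_reflection bc).
left; rewrite -(reflectionK c).
exact: cyclic_equiv_trans ab (cyclic_equiv_reflection bc).
Qed.

Lemma conjugate_simple a s t r : positive t -> positive r -> s * t = Delta3 ->
  a * s = Delta3 * r -> cyclic_or_reflection a (t * r).
Proof.
move=> pt pr st as_; right; rewrite reflectionM.
have -> : a = reflection r * reflection t.
  apply: (mulIg s); rewrite as_ -mulgA.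
  have -> : reflection t * s = Delta3.
    by rewrite reflectionE -st invgM !mulgA mulgK mulgVK.
  by rewrite reflectionE mulgVK.
by apply: cyclic_equiv_swap; apply: positive_reflection.
Qed.

Lemma conjugate_positive c a b : positive c -> positive a -> positive b ->
  a * c = c * b -> cyclic_or_reflection a b.
Proof.
move=> [w <-] {c}; have [n] := ubnP (size w).
have pS := positive_sigma; have pw u : positive (braid_of u) by exists u.
have pD := positive_Delta3.
elim: n => // n IHn in w a *; case: w => [|i w]; rewrite ltnS => lew pa pb.
  rewrite /braid_of big_nil mul1g mulg1 => <-; left.
  exact: cyclic_equiv_refl.
(* [u] spells what remains of the conjugator after [s]; it is shorter than [i :: w], so the
   induction continues from [t * r]. *)
have peel s t u r : braid_of (i :: w) = s * braid_of u -> size u <= size w ->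
    positive t -> positive r -> s * t = Delta3 -> a * s = Delta3 * r ->
    a * braid_of (i :: w) = braid_of (i :: w) * b -> cyclic_or_reflection a b.
  move=> -> uw pt pr st as_ e.
  apply: (cyclic_or_reflection_trans (conjugate_simple pt pr st as_)).
  apply: (IHn u) => //; [exact: leq_ltn_trans lew | exact: positive_mul |].
  apply: (mulgI s); rewrite [RHS]mulgA -e [RHS]mulgA as_ -st.
  by rewrite !mulgA.
have [_ Di] := Delta3_generators (~~ i); rewrite negbK in Di.
have [a1|[j da]] := positive_left_div pa.
  rewrite a1 mul1g => e; left; rewrite (_ : b = 1).
    exact/cyclic_equiv_refl/positive_one.
  by apply: (mulgI (braid_of (i :: w))); rewrite -e mulg1.
have [ij|ij] : j = i \/ j = ~~ i by case: (i); case: (j); auto.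
  subst j; case: da => a' pa' -> e.
  apply: (@cyclic_or_reflection_trans _ (a' * sigma i)).
    by left; apply: cyclic_equiv_swap.
  apply: (IHn w) => //; first exact: positive_mul.
  apply: (mulgI (sigma i)).
  by rewrite [RHS]mulgA -braid_of_cons -e braid_of_cons !mulgA.
subst j => e.
have dac : left_div i (a * braid_of (i :: w)).
  by rewrite e braid_of_cons -mulgA; apply/left_div_sigma/positive_mul.
(* [a] is already divisible by [sigma (~~ i)]. For [s] other than [Delta3], divisibility of [a * s]
   by [sigma i] comes from [dac] through [left_div_weighted]. *)
have simple s : positive s -> left_div i (a * s) ->
    exists2 r, positive r & a * s = Delta3 * r.
  by move=> ps ds; apply: (left_div_both ds); apply: left_divMr.
(* The cases below treat the greatest simple factor [sigma i], then [Delta3], then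
   [sigma i * sigma (~~ i)]. *)
have [[_ [u <-] wu]|nw] := pselect (left_div (~~ i) (braid_of w)); last first.
  have [|r pr as_] := simple _ (pS i).
    by apply: left_div_weighted nw _ => //; rewrite -mulgA -braid_of_cons.
  apply: (peel (sigma i) (sigma (~~ i) * sigma i) w r) => //.
  - by rewrite braid_of_cons.
  - exact: positive_mul.
  - by rewrite mulgA Di.
have su : size w = (size u).+1.
  by apply: (@braid_of_size w (~~ i :: u)); rewrite braid_of_cons.
have [[_ [v <-] uv]|nu] := pselect (left_div i (braid_of u)).
  have sv : size u = (size v).+1.
    by apply: (@braid_of_size u (i :: v)); rewrite braid_of_cons.
  apply: (peel Delta3 1 v (reflection a)) => //.
  - by rewrite braid_of_cons wu uv Di !mulgA.
  - by rewrite su sv !leqW.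
  - exact: positive_one.
  - exact: positive_reflection.
  - by rewrite mulg1.
  - by rewrite /reflection !mulgA mulgV mul1g.
have [||r pr as_] := simple (sigma i * sigma (~~ i)).
- exact: positive_mul.
- rewrite mulgA; apply: (@left_div_weighted _ _ _ (braid_of u)) => //.
  + exact: positive_mul.
  + by rewrite negbK.
  + by rewrite -!mulgA -wu -braid_of_cons.
apply: (peel (sigma i * sigma (~~ i)) (sigma i) u r) => //.
- by rewrite braid_of_cons wu mulgA.
- by rewrite su.
Qed.

Lemma conjugate_cyclic_or_reflection a b : positive a -> positive b ->
  conjugate a b -> cyclic_or_reflection a b.
Proof.
move=> pa pb [c eb]; have [k pc] := positive_denominator c.
have pak := positive_Delta3_expgN k pa.
(* Each [Delta3] put before [c] to make it positive reflects [a] once, which the relation absorbs,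
   so [k] may have either parity. *)
apply: (@cyclic_or_reflection_trans _ (Delta3 ^+ k * a * Delta3 ^- k)).
  elim: k {pc pak} => [|k IHk].
    by left; rewrite invg1 mulg1 mul1g; apply: cyclic_equiv_refl.
  apply: cyclic_or_reflection_trans IHk _; right.
  have -> : Delta3 ^+ k.+1 * a * Delta3 ^- k.+1 =
            reflection (Delta3 ^+ k * a * Delta3 ^- k).
    by rewrite reflectionE expgS invgM !mulgA.
  by rewrite reflectionK; apply/cyclic_equiv_refl/positive_Delta3_expgN.
apply: (conjugate_positive pc) => //.
by rewrite eb conjgE !mulgA mulgVK mulgK.
Qed.

Lemma reflection_conjugate a : conjugate (reflection a) a.
Proof. by exists Delta3; rewrite conjgE mulgA -/(reflection _) reflectionK. Qed.

Lemma cyclic_or_reflection_conjugate a b :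
  cyclic_or_reflection a b -> conjugate a b.
Proof.
case=> /cyclic_equiv_conjugate // -[c e].
have [d ->] := reflection_conjugate b.
by exists (c * d); rewrite conjgM -e.
Qed.

(** Moving a leading [Delta3] to the end is a single cyclic step, and it conjugates [a] by
    [Delta3]. *)
Lemma cyclic_equiv_reflection_self a : (1 <= infimum a :> int)%R ->
  cyclic_equiv a (reflection a).
Proof.
have [P [pP _]] := infimumP a; case: (infimum a) => [[|m]|m] // -> _.
have pm : positive (Delta3 ^+ m * P).
  exact/positive_mul/pP/positive_expg/positive_Delta3.
rewrite /= expgS -mulgA /reflection mulKg.
exact/cyclic_equiv_swap/pm/positive_Delta3.
Qed.

Theorem theorem1p1 (a b : B3) (ha : positive a) (hb : positive b) :
  (conjugate a b <-> cyclic_equiv a b \/ cyclic_equiv a (reflection b)) /\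
  ((1 <= infimum a :> int)%R -> (conjugate a b <-> cyclic_equiv a b)).
Proof.
have main : conjugate a b <-> cyclic_or_reflection a b.
  split; first exact: conjugate_cyclic_or_reflection.
  exact: cyclic_or_reflection_conjugate.
split=> // inf_a; split; last exact: cyclic_equiv_conjugate.
move=> /main[//|ab].
(* Passing through [reflection a] undoes the reflection of [b]. *)
apply: cyclic_equiv_trans (cyclic_equiv_reflection_self inf_a) _.
by rewrite -(reflectionK b); apply: cyclic_equiv_reflection.
Qed.
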